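(* Let $\Pi_{\mathsf{OWUTE}}$ be an untelegraphable secret-key encryption scheme with message space $\{\mathcal{M}_\lambda\}_{\lambda\in\mathbb{N}}$, let $\mathcal{H}$ be a universal hash family of size at most $2^{\mathrm{poly}(\lambda)}$ consisting of functions $h:\mathcal{M}_\lambda\to\{0,1\}$, and let $\Pi_{\mathsf{UTE}}$ be the scheme with message space $\{0,1\}$ built from $\Pi_{\mathsf{OWUTE}}$ and $\mathcal{H}$ by the One-Time UTE construction (defined in the context). Suppose $\Pi_{\mathsf{OWUTE}}$ is statistically one-way secure, where the maximum advantage (i.e. success probability) of any adversary in the one-way security game is $2^{-\Omega(\lambda)}$. Then $\Pi_{\mathsf{UTE}}$ satisfies statistical indistinguishability security.
   Context: $\lambda$ is the security parameter; QPT means quantum polynomial time; $x\xleftarrow{R}X$ denotes uniform sampling; $\mathrm{negl}$ denotes a negligible function. Untelegraphable secret-key encryption (UTSKE). A scheme with message space $\{\mathcal{M}_\lambda\}$ is a tuple of QPT algorithms $(\mathsf{Gen},\mathsf{Enc},\mathsf{Dec})$: $\mathsf{Gen}(1^\lambda)$ outputs a classical key $\mathsf{sk}$; $\mathsf{Enc}(\mathsf{sk},m)$ outputs a quantum ciphertext $|\mathsf{ct}\rangle$; $\mathsf{Dec}(\mathsf{sk},|\mathsf{ct}\rangle)$ outputs a message. Correctness: for all $\lambda$ and $m\in\mathcal{M}_\lambda$, $\Pr[\mathsf{Dec}(\mathsf{sk},\mathsf{Enc}(\mathsf{sk},m))=m:\mathsf{sk}\leftarrow\mathsf{Gen}(1^\lambda)]\ge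 1-\mathrm{negl}(\lambda)$. One-way security game for a two-stage adversary $(\mathcal{A},\mathcal{B})$: the challenger samples $\mathsf{sk}\leftarrow\mathsf{Gen}(1^\lambda)$, $m\xleftarrow{R}\mathcal{M}_\lambda$, $|\mathsf{ct}\rangle\leftarrow\mathsf{Enc}(\mathsf{sk},m)$ and gives $|\mathsf{ct}\rangle$ to $\mathcal{A}$; $\mathcal{A}$ outputs a classical string $\mathsf{st}$; $\mathcal{B}$ receives $(\mathsf{st},\mathsf{sk})$ and outputs $m_{\mathcal{B}}$; the adversary wins iff $m_{\mathcal{B}}=m$. Statistical one-way security: every (computationally unbounded) $(\mathcal{A},\mathcal{B})$ wins with negligible probability. Indistinguishability security game with bit $b$: $\mathcal{A}$ outputs $m_0,m_1\in\mathcal{M}_\lambda$; the challenger samples $\mathsf{sk}\leftarrow\mathsf{Gen}(1^\lambda)$ and gives $|\mathsf{ct}\rangle\leftarrow\mathsf{Enc}(\mathsf{sk},m_b)$ to $\mathcal{A}$; $\mathcal{A}$ outputs a classical string $\mathsf{st}$; $\mathcal{B}$ receives $(\mathsf{st},\mathsf{sk})$ and outputs a bit $b_{\mathcal{B}}$. Statistical indistinguishability security: for all (unbounded) $(\mathcal{A},\mathcal{B})$, $|\Pr[b_{\mathcal{B}}=1\mid b=0]-\Pr[b_{\mathcal{B}}=1\mid b=1]|=\mathrm{negl}(\lambda)$. One-Time UTE construction (message space $\{0,1\}$). - $\mathsf{Gen}(1^\lambda)$: sample $\mathsf{sk}_{\mathsf{OW}}\leftarrow\mathsf{OWUTE.Gen}(1^\lambda)$,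 $h\xleftarrow{R}\mathcal{H}$, $r\xleftarrow{R}\{0,1\}$; output $\mathsf{sk}=(\mathsf{sk}_{\mathsf{OW}},h,r)$. - $\mathsf{Enc}(\mathsf{sk},m)$: sample $x\xleftarrow{R}\mathcal{M}_\lambda$, compute $|\mathsf{ct}_{\mathsf{OW}}\rangle\leftarrow\mathsf{OWUTE.Enc}(\mathsf{sk}_{\mathsf{OW}},x)$; output $(|\mathsf{ct}_{\mathsf{OW}}\rangle,\ r\oplus h(x)\oplus m)$. - $\mathsf{Dec}(\mathsf{sk},(|\mathsf{ct}_{\mathsf{OW}}\rangle,r'))$: output $r'\oplus r\oplus h(\mathsf{OWUTE.Dec}(\mathsf{sk}_{\mathsf{OW}},|\mathsf{ct}_{\mathsf{OW}}\rangle))$. *)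

(* Defs.v *)
From HB Require Import structures.
From mathcomp Require Import all_boot all_order all_algebra.
From mathcomp Require Import spectral complex mxtens.
From mathcomp Require Import all_classical all_reals all_analysis.

Set Implicit Arguments.
Unset Strict Implicit.
Unset Printing Implicit Defensive.

Import Order.TTheory GRing.Theory Num.Theory.
Local Open Scope ring_scope.
Local Open Scope complex_scope.
Local Open Scope sesquilinear_scope.

(** ** Asymptotics *)

Definition negligible (R : realType) (f : nat -> R) : Prop :=
  forall c : nat, (\forall n \near \oo, `|f n| <= n%:R ^- c)%classic.

Definition poly_bounded (f : nat -> nat) : Prop :=
  exists k : nat, forall n : nat, (f n <= n ^ k + k)%N.

(** ** Finite-dimensional quantum mechanics *)

Definition is_dist (R : realType) (T : finType) (f : T -> R) : Prop :=
  (forall x, 0 <= f x) /\ \sum_x f x = 1.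

(* Over R[i], [0 <= z] says that z is real and nonnegative, so that this
   condition also forces A to be Hermitian. *)
Definition psdmx (R : realType) (d : nat) (A : 'M[R[i]]_d) : Prop :=
  forall v : 'rV[R[i]]_d, 0 <= (v *m A *m v ^t*) 0 0.

Definition density (R : realType) (d : nat) (A : 'M[R[i]]_d) : Prop :=
  psdmx A /\ \tr A = 1.

Definition povm (R : realType) (d : nat) (I : finType)
    (E : I -> 'M[R[i]]_d) : Prop :=
  (forall i, psdmx (E i)) /\ \sum_i E i = 1%:M.

Definition born (R : realType) (d : nat) (E rho : 'M[R[i]]_d) : R :=
  complex.Re (\tr (E *m rho)).

(* The operator |b><b| (x) A on the Hilbert space C^2 (x) C^d. *)
Definition cq (R : realType) (d : nat) (b : bool) (A : 'M[R[i]]_d) :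
    'M[R[i]]_(d + d) :=
  if b then block_mx 0 0 0 A else block_mx A 0 0 0.

(** ** Polynomial-time Turing machines *)

(* One tape, infinite in both directions; [tm_step] returns the new state, the
   symbol written and whether the head moves right, and [None] halts. *)
Record tm := TM {
  tm_state : finType;
  tm_sym : finType;
  tm_start : tm_state;
  tm_blank : tm_sym;
  tm_bit : bool -> tm_sym;
  tm_step : tm_state -> tm_sym -> option (tm_state * tm_sym * bool);
  tm_bit_inj : injective tm_bit;
  tm_bit_blank : forall b, tm_bit b != tm_blank }.

(* State, cells left of the head (nearest first), cells from the head on. *)
Definition tm_config (M : tm) : Type :=
  (tm_state M * seq (tm_sym M) * seq (tm_sym M))%type.

Definition tm_next (M : tm) (c : tm_config M) : option (tm_config M) :=
  let: (q, l, r) := c in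
  if tm_step q (head (tm_blank M) r) is Some (q', a, rt) then
    Some (if rt then (q', a :: l, behead r)
          else (q', behead l, head (tm_blank M) l :: a :: behead r))
  else None.

Definition tm_run (M : tm) (t : nat) (w : seq bool) : tm_config M :=
  iter t (fun c => odflt c (tm_next c)) (tm_start M, [::], map (@tm_bit M) w).

Definition tm_outputs (M : tm) (t : nat) (w v : seq bool) : Prop :=
  let c := tm_run M t w in
  tm_next c = None /\
  exists j, c.2 = map (@tm_bit M) v ++ nseq j (tm_blank M).

(* The function 1^n |-> f n is computable in polynomial time. *)
Definition unary_polytime (f : nat -> seq bool) : Prop :=
  exists (M : tm) (k : nat), forall n : nat,
    tm_outputs M (n ^ k + k)%N (nseq n true) (f n).

(** ** Uniform quantum circuits *)

(* The little-endian label of the i-th computational basis vector of n qubits. *)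
Definition bits (n i : nat) : seq bool :=
  mkseq (fun t => odd (i %/ 2 ^ t)%N) n.

Record gate (R : realType) := Gate {
  arity : nat;
  gate_mx : 'M[R[i]]_(2 ^ arity);
  gate_unitary : gate_mx \is unitarymx }.

(* Each operation is the index of a gate and the wires it is applied to; the
   first [out] wires are the output of the circuit. *)
Record circuit (g : nat) := Circuit {
  wires : nat;
  out : nat;
  ops : seq ('I_g * seq nat) }.

Definition circuit_wf (R : realType) (g : nat) (G : 'I_g -> gate R)
    (c : circuit g) : Prop :=
  (out c <= wires c)%N /\
  all (fun o => [&& size o.2 == arity (G o.1), uniq o.2
                  & all (fun w => w < wires c)%N o.2]) (ops c).

Definition code_nat (n : nat) : seq bool := rcons (nseq n true) false.

Definition code_op (g : nat) (o : 'I_g * seq nat) : seq bool :=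
  code_nat o.1 ++ code_nat (size o.2) ++ flatten (map code_nat o.2).

Definition code_circuit (g : nat) (c : circuit g) : seq bool :=
  code_nat (wires c) ++ code_nat (out c) ++ flatten (map (@code_op g) (ops c)).

Definition apply_gate (R : realType) (n : nat) (U : gate R) (ws : seq nat) :
    'M[R[i]]_(2 ^ n) :=
  \matrix_(i, j)
    if all (fun w => (w \in ws) ||
                     (nth false (bits n i) w == nth false (bits n j) w))
           (iota 0 n)
    then \sum_(a < 2 ^ arity U | bits (arity U) a == map (nth false (bits n i)) ws)
         \sum_(b < 2 ^ arity U | bits (arity U) b == map (nth false (bits n j)) ws)
           gate_mx U a b
    else 0.

Definition circuit_mx (R : realType) (g : nat) (G : 'I_g -> gate R)
    (c : circuit g) : 'M[R[i]]_(2 ^ wires c) :=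
  foldl (fun V o => apply_gate (wires c) (G o.1) o.2 *m V) 1%:M (ops c).

(* Kraus form of the operation performed by a circuit: the wires are
   initialised to |s> (x) rho (x) |0...0>, the unitary is applied, and all but
   the first [out c] wires are traced out. *)
Definition circuit_out (R : realType) (g : nat) (G : 'I_g -> gate R)
    (c : circuit g) (s : seq bool) (q : nat) (rho : 'M[R[i]]_(2 ^ q)) :
    'M[R[i]]_(2 ^ out c) :=
  let n := wires c in
  let J : 'M[R[i]]_(2 ^ n, 2 ^ q) := \matrix_(i, j)
    (bits n i == s ++ bits q j ++ nseq (n - (size s + q)) false)%:R in
  \sum_(w : (n - out c).-tuple bool)
    let K : 'M[R[i]]_(2 ^ out c, 2 ^ n) := \matrix_(i, j)
      (bits n j == bits (out c) i ++ w)%:R in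
    let W := K *m circuit_mx G c *m J in
    W *m rho *m W ^t*.

Definition circuit_measure (R : realType) (g : nat) (G : 'I_g -> gate R)
    (c : circuit g) (s : seq bool) (q : nat) (rho : 'M[R[i]]_(2 ^ q))
    (x : seq bool) : R :=
  complex.Re (\sum_(i < 2 ^ out c | bits (out c) i == x) circuit_out G c s rho i i).

Definition poly_circuits (R : realType) (g : nat) (G : 'I_g -> gate R)
    (C : nat -> circuit g) : Prop :=
  (forall l, circuit_wf G (C l)) /\
  unary_polytime (fun l => code_circuit (C l)).

(** ** Secret-key encryption with quantum ciphertexts *)

(* [gen l] is the distribution of the key, [enc l k m] the density matrix of
   the ciphertext, and [dec l k] the measurement whose outcome is the decrypted
   message. *)
Record ske (R : realType) := SKE {
  key : nat -> finType;
  msg : nat -> finType;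
  ctdim : nat -> nat;
  gen : forall l, key l -> R;
  enc : forall l, key l -> msg l -> 'M[R[i]]_(ctdim l);
  dec : forall l, key l -> msg l -> 'M[R[i]]_(ctdim l);
  msg_gt0 : forall l, (0 < #|msg l|)%N;
  gen_dist : forall l, is_dist (@gen l);
  enc_density : forall l k m, density (@enc l k m);
  dec_povm : forall l k, povm (@dec l k) }.

Arguments gen {R} s l.
Arguments enc {R} s l.
Arguments dec {R} s l.

(* Gen, Enc and Dec are implemented by polynomial-time uniform families of
   quantum circuits over some finite gate set, for some representation of keys
   and messages as bit strings ([read_msg] interprets every output of the
   decryption circuit as a message).  The entries of the gates are arbitrary complex
   numbers, so no particular universal gate set is imposed. *)
Definition qpt (R : realType) (P : ske R) : Prop :=
  exists (g : nat) (G : 'I_g -> gate R) (Cgen Cenc Cdec : nat -> circuit g)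
    (code_key : forall l, key P l -> (out (Cgen l)).-tuple bool)
    (code_msg : forall l, msg P l -> (out (Cdec l)).-tuple bool)
    (read_msg : forall l, (out (Cdec l)).-tuple bool -> msg P l)
    (ctE : forall l, ctdim P l = (2 ^ out (Cenc l))%N),
    [/\ poly_circuits G Cgen, poly_circuits G Cenc & poly_circuits G Cdec] /\
    forall l : nat,
    [/\ injective (code_key l), cancel (code_msg l) (read_msg l),
        (out (Cgen l) + out (Cdec l) <= wires (Cenc l))%N
      & (out (Cgen l) + out (Cenc l) <= wires (Cdec l))%N] /\
    [/\ forall k, gen P l k =
          circuit_measure G (Cgen l) [::] (1%:M : 'M[R[i]]_(2 ^ 0)) (code_key l k),
        forall k m, castmx (ctE l, ctE l) (enc P l k m) =
          circuit_out G (Cenc l) (code_key l k ++ code_msg l m)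
            (1%:M : 'M[R[i]]_(2 ^ 0))
      & forall k m rho, density rho ->
          born (castmx (ctE l, ctE l) (dec P l k m)) rho =
          \sum_(x | read_msg l x == m)
             circuit_measure G (Cdec l) (code_key l k) rho x].

Definition correct (R : realType) (P : ske R) : Prop :=
  exists nu : nat -> R, negligible nu /\
    forall l (m : msg P l),
      1 - nu l <= \sum_k gen P l k * born (dec P l k m) (enc P l k m).

Definition utske (R : realType) (P : ske R) : Prop := qpt P /\ correct P.

(** ** One-way security *)

(* [ow_A] is the measurement producing the classical string st; B, having only
   classical inputs, is given by the distribution of its output. *)
Record ow_adv (R : realType) (P : ske R) (l : nat) := OwAdv {
  ow_len : nat;
  ow_A : ow_len.-tuple bool -> 'M[R[i]]_(ctdim P l);
  ow_B : ow_len.-tuple bool -> key P l -> msg P l -> R;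
  ow_A_povm : povm ow_A;
  ow_B_dist : forall st k, is_dist (ow_B st k) }.

Arguments ow_A {R P l} o st.
Arguments ow_B {R P l} o st k.

Definition ow_win (R : realType) (P : ske R) (l : nat) (a : ow_adv P l) : R :=
  \sum_k gen P l k * \sum_m #|msg P l|%:R^-1 *
    \sum_st born (ow_A a st) (enc P l k m) * ow_B a st k m.

Definition ow_secure (R : realType) (P : ske R) : Prop :=
  forall a : (forall l, ow_adv P l), negligible (fun l => ow_win (a l)).

Definition ow_max_adv (R : realType) (P : ske R) (l : nat) : R :=
  sup (range (@ow_win R P l))%classic.

Definition exp_small (R : realType) (f : nat -> R) : Prop :=
  exists2 c : R, 0 < c &
    (\forall n \near \oo, f n <= 2 `^ (- (c * n%:R)))%classic.

(** ** Indistinguishability security *)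

(* The first stage of A outputs (m0, m1) and keeps a quantum memory:
   [ind_A1 m0 m1] is the memory state scaled by the probability of (m0, m1).
   The second stage measures the ciphertext together with the memory. *)
Record ind_adv (R : realType) (P : ske R) (l : nat) := IndAdv {
  ind_dim : nat;
  ind_len : nat;
  ind_A1 : msg P l -> msg P l -> 'M[R[i]]_ind_dim;
  ind_A2 : ind_len.-tuple bool -> 'M[R[i]]_(ctdim P l * ind_dim);
  ind_B : ind_len.-tuple bool -> key P l -> bool -> R;
  ind_A1_psd : forall m0 m1, psdmx (ind_A1 m0 m1);
  ind_A1_tr : \sum_m0 \sum_m1 \tr (ind_A1 m0 m1) = 1;
  ind_A2_povm : povm ind_A2;
  ind_B_dist : forall st k, is_dist (ind_B st k) }.

Arguments ind_A1 {R P l} i.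
Arguments ind_A2 {R P l} i st.
Arguments ind_B {R P l} i st k.

(* Pr[b_B = 1 | b] *)
Definition ind_out1 (R : realType) (P : ske R) (l : nat) (a : ind_adv P l)
    (b : bool) : R :=
  \sum_m0 \sum_m1 \sum_k gen P l k *
    \sum_st born (ind_A2 a st)
                 (enc P l k (if b then m1 else m0) *t ind_A1 a m0 m1)
            * ind_B a st k true.

Definition ind_secure (R : realType) (P : ske R) : Prop :=
  forall a : (forall l, ind_adv P l),
    negligible (fun l => `|ind_out1 (a l) false - ind_out1 (a l) true|).

(** ** Universal hashing *)

Record hash_family (M : nat -> finType) := HashFamily {
  hashes :> forall l, {set {ffun M l -> bool}};
  hashes_gt0 : forall l, (0 < #|hashes l|)%N }.

(* Collision probability at most 1/2, the inverse of the size of the range. *)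
Definition universal (M : nat -> finType) (H : hash_family M) : Prop :=
  forall l (x y : M l), x != y ->
    (#|[set h in H l | h x == h y]|%:R / #|H l|%:R <= 1 / 2%:R :> rat).

Definition exp_poly_size (M : nat -> finType) (H : hash_family M) : Prop :=
  exists2 p : nat -> nat, poly_bounded p & forall l, (#|H l| <= 2 ^ p l)%N.

(** ** The one-time construction *)

Section OneTime.
Variables (R : realType) (P : ske R) (H : hash_family (msg P)).

Definition ute_key (l : nat) : finType :=
  (key P l * {ffun msg P l -> bool} * bool)%type.

Definition ute_gen l (sk : ute_key l) : R :=
  let: (k, h, _) := sk in
  gen P l k * ((h \in H l)%:R / #|H l|%:R) * 2^-1.

Definition ute_enc l (sk : ute_key l) (m : bool) : 'M[R[i]]_(ctdim P l + ctdim P l) :=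
  let: (k, h, r) := sk in
  \sum_x #|msg P l|%:R^-1 *: cq (r (+) h x (+) m) (enc P l k x).

Definition ute_dec l (sk : ute_key l) (m : bool) : 'M[R[i]]_(ctdim P l + ctdim P l) :=
  let: (k, h, r) := sk in
  \sum_(r' : bool) cq r' (\sum_(x | r' (+) r (+) h x == m) dec P l k x).

Lemma ute_gen_dist l : is_dist (@ute_gen l).
Proof.
have [g0 g1] := gen_dist P l; split=> [[[k h] r]|] /=.
  by rewrite !mulr_ge0 ?invr_ge0 ?ler0n.
have nz : (#|H l|%:R : R) != 0 by rewrite pnatr_eq0 -lt0n hashes_gt0.
rewrite (eq_bigr (fun p : ute_key l =>
  gen P l p.1.1 * ((p.1.2 \in H l)%:R / #|H l|%:R) * 2^-1)); last by case=> [[]].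
rewrite -(pair_bigA _ (fun p (r : bool) =>
  gen P l p.1 * ((p.2 \in H l)%:R / #|H l|%:R) * 2^-1)) /=.
rewrite (eq_bigr (fun p => gen P l p.1 * ((p.2 \in H l)%:R / #|H l|%:R))); last first.
  by move=> p _; rewrite big_bool /= -splitr.
rewrite -(pair_bigA _ (fun k h => gen P l k * ((h \in H l)%:R / #|H l|%:R))) /=.
rewrite -[RHS]g1; apply: eq_bigr => k _.
rewrite -mulr_sumr -mulr_suml -natr_sum -[RHS]mulr1; congr (_ * _).
by rewrite -big_mkcond /= sum1_card divff.
Qed.

Lemma psdmx_cq d b (A : 'M[R[i]]_d) : psdmx A -> psdmx (cq b A).
Proof.
move=> pA v; rewrite -(hsubmxK v) /cq.
rewrite -[X in _ *m X]/((row_mx (lsubmx v) (rsubmx v)) ^t*).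
rewrite tr_row_mx map_col_mx.
by case: b; rewrite mul_row_block !mulmx0 ?addr0 ?add0r mul_row_col mul0mx
  ?addr0 ?add0r; exact: pA.
Qed.

Lemma psdmx_sum d (I : finType) (Q : pred I) (F : I -> 'M[R[i]]_d) :
  (forall i, psdmx (F i)) -> psdmx (\sum_(i | Q i) F i).
Proof.
move=> pF v; rewrite mulmx_sumr mulmx_suml summxE.
by apply: sumr_ge0 => i _; exact: pF.
Qed.

Lemma ute_enc_density l sk m : density (@ute_enc l sk m).
Proof.
case: sk => [[k h] r] /=; split.
  apply: psdmx_sum => x v.
  have [p _] := enc_density k x.
  rewrite -scalemxAr -scalemxAl mxE mulr_ge0 ?invr_ge0 ?ler0n //.
  exact: psdmx_cq.
have nz : (#|msg P l|%:R : R[i]) != 0 by rewrite pnatr_eq0 -lt0n msg_gt0.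
rewrite linear_sum /= (eq_bigr (fun=> #|msg P l|%:R^-1)).
  by rewrite sumr_const -[#|_|]/(#|msg P l|) -[LHS]mulr_natr mulVf.
move=> x _; rewrite linearZ /= /cq; have [_ t] := enc_density k x.
by case: (_ (+) m); rewrite mxtrace_block linear0 t ?add0r ?addr0 mulr1.
Qed.

Lemma ute_dec_povm l sk : povm (@ute_dec l sk).
Proof.
case: sk => [[k h] r] /=; have [p s] := dec_povm k; split=> [m|].
  by apply: psdmx_sum => r'; apply: psdmx_cq; apply: psdmx_sum.
have sE r' : \sum_(m : bool) \sum_(x | r' (+) r (+) h x == m) dec P l k x = 1%:M.
  by rewrite -s [RHS](partition_big (fun x => r' (+) r (+) h x) xpredT).
rewrite exchange_big big_bool /= /cq !big_bool /=.
move: (sE true) (sE false); rewrite !big_bool /= => e1 e2.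
by rewrite !add_block_mx !addr0 !add0r e1 e2 -scalar_mx_block.
Qed.

Fact card_bool_gt0 : (0 < #|{: bool}|)%N.
Proof. by rewrite card_bool. Qed.

Definition ute : ske R :=
  @SKE R ute_key (fun=> bool) (fun l => (ctdim P l + ctdim P l)%N)
    ute_gen ute_enc ute_dec
    (fun=> card_bool_gt0) ute_gen_dist ute_enc_density ute_dec_povm.

End OneTime.

(* Main.v *)
Require Import Defs.
From mathcomp Require Import all_boot all_order all_algebra.
From mathcomp Require Import spectral complex mxtens.
From mathcomp Require Import all_classical all_reals all_analysis.
From mathcomp Require Import ring lra.

(** The pad [r] makes the classical part of the ciphertext a uniform bit
    independent of everything else, so the first-stage adversary can sample it,
    together with its challenge messages and its memory, by itself: what it does
    to the one-way ciphertext is a single measurement with outcomes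
    [((m0, m1), (st, b))].  Given such an outcome, the key and [h], the second
    stage has to tell [h x] from its negation, where [x] is distributed according
    to some subnormalised weights [q] and [h] is independent of [q].  Universality
    bounds the mean square over [h] of the bias [\sum_x (-1) ^ h x q x] by
    [\sum_x q x ^ 2 <= (max q) (\sum_x q x)], and [max q], averaged over the
    outcomes and keys, is the success probability of the one-way adversary which
    outputs the likeliest [x].  AM-GM with a parameter [eps] bounds the
    distinguishing advantage by [eps + ow_max_adv / eps], and [eps] is taken to
    be the square root of the exponential bound on [ow_max_adv]. *)

Set Implicit Arguments.
Unset Strict Implicit.
Unset Printing Implicit Defensive.

Import Order.TTheory GRing.Theory Num.Theory.
Local Open Scope ring_scope.
Local Open Scope sesquilinear_scope.

(** * Adjoints, traces and tensor products of matrices *)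

Lemma trmxC_mul (C : numClosedFieldType) m n p (A : 'M[C]_(m, n)) (B : 'M[C]_(n, p)) :
  (A *m B) ^t* = B ^t* *m A ^t*.
Proof. by rewrite trmx_mul map_mxM. Qed.

Lemma trmxC_tens (C : numClosedFieldType) m n p q (A : 'M[C]_(m, n)) (B : 'M[C]_(p, q)) :
  (A *t B) ^t* = A ^t* *t B ^t*.
Proof. by rewrite trmx_tens map_mxT. Qed.

Lemma mxtrace_tens (R : comPzRingType) m n (A : 'M[R]_m) (B : 'M[R]_n) :
  \tr (A *t B) = \tr A * \tr B.
Proof. by rewrite /mxtrace mulr_sum; apply: eq_bigr => i _; rewrite mxE. Qed.

Lemma tensmxDl (R : pzRingType) m n p q (A B : 'M[R]_(m, n)) (C : 'M[R]_(p, q)) :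
  (A + B) *t C = A *t C + B *t C.
Proof. by apply/matrixP => i j; rewrite !mxE mulrDl. Qed.

Lemma tensmxZl (R : pzRingType) m n p q a (A : 'M[R]_(m, n)) (C : 'M[R]_(p, q)) :
  (a *: A) *t C = a *: (A *t C).
Proof. by apply/matrixP => i j; rewrite !mxE mulrA. Qed.

Lemma tensmx_suml (R : pzRingType) m n p q (I : finType) (F : I -> 'M[R]_(m, n))
    (C : 'M[R]_(p, q)) :
  (\sum_i F i) *t C = \sum_i F i *t C.
Proof.
by apply: (big_morph (fun A => A *t C)) => [A B|]; rewrite ?tensmxDl ?tens0mx.
Qed.

(** * Positive matrices are Gram matrices *)

Section Positive.
Variable C : numClosedFieldType.

(* [psdmx] over an abstract closed field, where no second conjugation (that of
   [complex]) gets in the way of rewriting. *)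
Definition positive_mx d (A : 'M[C]_d) : Prop :=
  forall v : 'rV_d, 0 <= (v *m A *m v ^t*) 0 0.

(** Polarisation: [f u v + f v u] is a combination of values of the quadratic form, hence real.
    Taking [u] to be a basis vector, then ['i] times it, controls the sum and the difference of
    [A i j] and [A j i]. *)
Lemma positive_mx_hermsym d (A : 'M[C]_d) : positive_mx A -> A \is hermsymmx.
Proof.
move=> pA; apply/is_hermitianmxP; rewrite expr0 scale1r.
pose f (u v : 'rV[C]_d) := (u *m A *m v ^t*) 0 0.
have fD u v : f (u + v) (u + v) = f u u + f v v + (f u v + f v u).
  rewrite /f raddfD /= map_mxD mulmxDr !mulmxDl !mxE; ring.
have fE i j : f (delta_mx 0 i) (delta_mx 0 j) = A i j.
  by rewrite /f -rowE trmx_delta map_delta_mx -colE !mxE.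
have real (u : 'rV[C]_d) : (f u u)^* = f u u.
  by apply: conj_Creal; apply: ger0_real; exact: pA.
have sym u v : (f u v + f v u)^* = f u v + f v u.
  have -> : f u v + f v u = f (u + v) (u + v) - f u u - f v v by rewrite fD; ring.
  by rewrite !rmorphB /= !real.
have fZl a u v : f (a *: u) v = a * f u v by rewrite /f -!scalemxAl mxE.
have fZr a u v : f u (a *: v) = a^* * f u v.
  by rewrite /f linearZ /= map_mxZ -scalemxAr mxE.
apply/matrixP => i j; rewrite !mxE.
have := sym (delta_mx 0 i) (delta_mx 0 j).
have := sym ('i *: delta_mx 0 i) (delta_mx 0 j).
rewrite !fZl !fZr !fE !rmorphD !rmorphM /= conjCK conjCi => e1 e2.
have e3 : (A j i)^* - (A i j)^* = A i j - A j i.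
  by apply: (mulfI (neq0Ci C)); rewrite mulrBr addrC -mulNr e1; ring.
have n2 : (2%:R : C) != 0 by rewrite pnatr_eq0.
apply: (mulfI n2).
have -> : 2%:R * A i j = (A i j - A j i) + (A i j + A j i) by ring.
by rewrite -e2 -e3; ring.
Qed.

Lemma positive_mx_gram d (A : 'M[C]_d) :
  positive_mx A -> exists B : 'M[C]_d, A = B ^t* *m B.
Proof.
move=> pA; have /hermitian_normalmx/orthomx_spectralP := positive_mx_hermsym pA.
set P := spectralmx A; set s := spectral_diag A => AE.
have uP : P \is unitarymx by exact: spectral_unitarymx.
have s0 i : 0 <= s 0 i.
  have := pA (row i P); suff -> : (row i P *m A *m (row i P) ^t*) 0 0 = s 0 i by [].
  have -> : (row i P *m A *m (row i P) ^t*) 0 0 = (P *m A *m P ^t*) i i.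
    by rewrite -row_mul !mxE; apply: eq_bigr => j _; rewrite !mxE.
  rewrite AE !mulmxA mulmxV ?unitarymx_unit// mul1mx -mulmxA (unitarymxP uP).
  by rewrite mulmx1 mxE eqxx.
(* The eigenvalues [s] are nonnegative, so their square roots are real and the adjoint leaves the
   diagonal factor unchanged. *)
exists (diag_mx (\row_i sqrtC (s 0 i)) *m P).
rewrite trmxC_mul tr_diag_mx map_diag_mx -invmx_unitary// mulmxA -(mulmxA (invmx P)).
rewrite mulmx_diag {1}AE; congr (_ *m diag_mx _ *m _); apply/rowP => i.
by rewrite !mxE /= conj_Creal -?expr2 ?sqrtCK// ger0_real// sqrtC_ge0.
Qed.

(** By cyclicity the trace is the sum of the quadratic form of [A] over the rows of [B]. *)
Lemma mxtrace_gram_ge0 m d (A : 'M[C]_d) (B : 'M[C]_(m, d)) :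
  positive_mx A -> 0 <= \tr (A *m (B ^t* *m B)).
Proof.
move=> pA; rewrite mulmxA mxtrace_mulC mulmxA; apply: sumr_ge0 => i _.
have -> : (B *m A *m B ^t*) i i = (row i B *m A *m (row i B) ^t*) 0 0.
  by rewrite -row_mul !mxE; apply: eq_bigr => j _; rewrite !mxE.
exact: pA.
Qed.

End Positive.

Local Open Scope complex_scope.

(** * The Born rule and effects on part of a system *)

Section Born.
Variable R : realType.
Local Notation C := R[i].

Lemma born_ge0 d (E rho : 'M[C]_d) : psdmx E -> psdmx rho -> 0 <= born E rho.
Proof.
move=> pE /(@positive_mx_gram _ _ rho)[B ->].
have t0 := mxtrace_gram_ge0 B pE.
by rewrite /born -lecR RRe_real ?ger0_real.
Qed.

Lemma Re_sum (I : finType) (Q : pred I) (z : I -> C) :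
  complex.Re (\sum_(i | Q i) z i) = \sum_(i | Q i) complex.Re (z i).
Proof. by apply: big_morph => // [[a b] [c e]]. Qed.

Lemma born_suml d (I : finType) (Q : pred I) (E : I -> 'M[C]_d) rho :
  born (\sum_(i | Q i) E i) rho = \sum_(i | Q i) born (E i) rho.
Proof. by rewrite /born mulmx_suml (raddf_sum (mxtrace (n := d))) Re_sum. Qed.

Lemma born_sumr d (I : finType) (Q : pred I) E (rho : I -> 'M[C]_d) :
  born E (\sum_(i | Q i) rho i) = \sum_(i | Q i) born E (rho i).
Proof. by rewrite /born mulmx_sumr (raddf_sum (mxtrace (n := d))) Re_sum. Qed.

Lemma Re_invn_mul n (z : C) : complex.Re (n%:R^-1 * z) = n%:R^-1 * complex.Re z.
Proof.
have -> : (n%:R^-1 : C) = (n%:R^-1)%:C by rewrite fmorphV rmorph_nat.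
by case: z => a b /=; rewrite mul0r subr0.
Qed.

Lemma born_invnl d n (E rho : 'M[C]_d) :
  born (n%:R^-1 *: E) rho = n%:R^-1 * born E rho.
Proof. by rewrite /born -scalemxAl linearZ /= Re_invn_mul. Qed.

Lemma born_invnr d n (E rho : 'M[C]_d) :
  born E (n%:R^-1 *: rho) = n%:R^-1 * born E rho.
Proof. by rewrite /born -scalemxAr linearZ /= Re_invn_mul. Qed.

Lemma born_sum_povm d (I : finType) (E : I -> 'M[C]_d) rho :
  povm E -> density rho -> \sum_i born (E i) rho = 1.
Proof. by move=> [_ E1] [_ t1]; rewrite -born_suml E1 /born mul1mx t1. Qed.

Lemma cqD d b (A B : 'M[C]_d) : cq b (A + B) = cq b A + cq b B.
Proof. by case: b; rewrite /cq add_block_mx !addr0. Qed.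

Lemma cqZ d b a (A : 'M[C]_d) : cq b (a *: A) = a *: cq b A.
Proof. by case: b; rewrite /cq scale_block_mx !scaler0. Qed.

Lemma cq_sum d b (I : finType) (F : I -> 'M[C]_d) :
  cq b (\sum_i F i) = \sum_i cq b (F i).
Proof.
apply: (big_morph (cq b)) => [A B|]; first exact: cqD.
by case: b; rewrite /cq block_mx0.
Qed.

Lemma mxtrace_cq d b (A : 'M[C]_d) : \tr (cq b A) = \tr A.
Proof. by case: b; rewrite /cq mxtrace_block linear0 ?addr0 ?add0r. Qed.

(* The effect on the quantum ciphertext obtained by supplying the classical bit
   [b] and the memory state [S] to the joint effect [A]. *)
Definition partial_effect d n (b : bool) (S : 'M[C]_n) (A : 'M[C]_((d + d) * n)) :
    'M[C]_d :=
  \matrix_(i, j) \tr (A *m (cq b (delta_mx j i) *t S)).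

(** Both sides are linear in [rho], and on matrix units they agree by definition. *)
Lemma mxtrace_partial_effect d n b (S : 'M[C]_n) (A : 'M[C]_((d + d) * n)) rho :
  \tr (partial_effect b S A *m rho) = \tr (A *m (cq b rho *t S)).
Proof.
have -> : \tr (partial_effect b S A *m rho) =
    \sum_i \sum_j partial_effect b S A j i * rho i j.
  by rewrite exchange_big; apply: eq_bigr => j _; rewrite mxE.
rewrite [in RHS](matrix_sum_delta rho).
rewrite cq_sum tensmx_suml mulmx_sumr (raddf_sum (mxtrace (n := _))) /=.
apply: eq_bigr => i _.
rewrite cq_sum tensmx_suml mulmx_sumr (raddf_sum (mxtrace (n := _))) /=.
apply: eq_bigr => j _.
by rewrite mxE cqZ tensmxZl -scalemxAr linearZ /= mulrC.
Qed.

Lemma born_partial_effect d n b (S : 'M[C]_n) (A : 'M[C]_((d + d) * n)) rho :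
  born (partial_effect b S A) rho = born A (cq b rho *t S).
Proof. by rewrite /born mxtrace_partial_effect. Qed.

(** The quadratic form at [v] is the trace of [A] against the classical bit, the projector on [v]
    and the memory together; these form a single Gram matrix. *)
Lemma psdmx_partial_effect d n b (S : 'M[C]_n) (A : 'M[C]_((d + d) * n)) :
  psdmx S -> psdmx A -> psdmx (partial_effect b S A).
Proof.
move=> /(@positive_mx_gram _ _ S)[B ->] pA v.
have -> : (v *m partial_effect b (B ^t* *m B) A *m v ^t*) 0 0 =
    \tr (partial_effect b (B ^t* *m B) A *m (v ^t* *m v)).
  by rewrite [in RHS]mulmxA [in RHS]mxtrace_mulC [in RHS]mulmxA trace_mx11.
rewrite mxtrace_partial_effect.
pose V : 'rV[C]_(d + d) := if b then row_mx 0 v else row_mx v 0.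
have -> : cq b (v ^t* *m v) = V ^t* *m V.
  by rewrite /V /cq; case: (b); rewrite tr_row_mx map_col_mx mul_col_row
    ?trmx0 ?map_mx0 ?mul0mx ?mulmx0.
by rewrite -tensmx_mul -trmxC_tens; exact: mxtrace_gram_ge0.
Qed.

End Born.

(** * Guessing the message in the one-way game *)

Section Guessing.
Variables (R : realType) (P : ske R) (l : nat).

Lemma is_dist_le1 (T : finType) (f : T -> R) x : is_dist f -> f x <= 1.
Proof. by move=> [f0 <-]; rewrite (bigD1 x)//= lerDl sumr_ge0. Qed.

Lemma msg_inv_sum : \sum_(m : msg P l) (#|msg P l|%:R^-1 : R) = 1.
Proof.
rewrite sumr_const -[#|_|]/(#|msg P l|) -[LHS]mulr_natr mulVf//.
by rewrite pnatr_eq0 -lt0n msg_gt0.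
Qed.

(** This boundedness makes the supremum [ow_max_adv] a genuine upper bound. *)
Lemma ow_win_le1 (a : ow_adv P l) : ow_win a <= 1.
Proof.
have [g0 g1] := gen_dist P l.
rewrite -[leRHS]g1 /ow_win; apply: ler_sum => k _ /=; apply: ler_piMr; first exact: g0.
rewrite -[leRHS]msg_inv_sum; apply: ler_sum => m _. apply: ler_piMr.
  by rewrite invr_ge0 ler0n.
rewrite -(born_sum_povm (ow_A_povm a) (enc_density k m)).
apply: ler_sum => st _; apply: ler_piMr; last by apply: is_dist_le1; exact: ow_B_dist.
by apply: born_ge0; [case: (ow_A_povm a)|case: (enc_density k m)].
Qed.

Lemma ow_win_le_max (a : ow_adv P l) : ow_win a <= ow_max_adv P l.
Proof.
apply: ub_le_sup; last by exists a.
by exists 1 => _ [b _ <-]; exact: ow_win_le1.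
Qed.

(** An injective code for outcomes of any finite type, as the first stage of [ow_adv] must output a
    bit string. *)
Definition one_hot (I : finType) (i : I) : #|I|.-tuple bool :=
  [tuple j == enum_rank i | j < #|I|].

Lemma one_hot_inj (I : finType) : injective (@one_hot I).
Proof.
move=> i j /(congr1 (fun t => tnth t (enum_rank i))).
by rewrite !tnth_mktuple eqxx => /esym/eqP/enum_rank_inj.
Qed.

(** The adversary behind the bound measures [E], sends the code of the outcome [i], and answers
    [g i k] once the key [k] is known. *)
Lemma ow_guess_le (I : finType) (E : I -> 'M[R[i]]_(ctdim P l))
    (g : I -> key P l -> msg P l) : povm E ->
  \sum_k gen P l k *
    \sum_i #|msg P l|%:R^-1 * born (E i) (enc P l k (g i k)) <= ow_max_adv P l.
Proof.
move=> [pE sE]; have /card_gt0P[m0 _] := msg_gt0 P l.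
pose A (st : #|I|.-tuple bool) := \sum_(i | one_hot i == st) E i.
(* A string coding no outcome has effect 0, so the default [m0] contributes nothing. *)
pose guess (st : #|I|.-tuple bool) k :=
  if [pick i | one_hot i == st] is Some i then g i k else m0.
pose B st k m : R := (m == guess st k)%:R.
have pA : povm A.
  split=> [st|]; first exact: psdmx_sum.
  by rewrite -sE [RHS](partition_big (@one_hot I) xpredT).
have dB st k : is_dist (B st k).
  split=> [m|]; first exact: ler0n.
  by rewrite -natr_sum -big_mkcond /= big_pred1_eq.
have guessE i k : guess (one_hot i) k = g i k.
  by rewrite /guess; case: pickP => [j /eqP/one_hot_inj ->|/(_ i)/eqP].
suff <- : ow_win (OwAdv pA dB) =
    \sum_k gen P l k * \sum_i #|msg P l|%:R^-1 * born (E i) (enc P l k (g i k)).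
  exact: ow_win_le_max.
apply: eq_bigr => k _; congr (_ * _) => /=.
transitivity (\sum_m \sum_i
    #|msg P l|%:R^-1 * (born (E i) (enc P l k m) * (m == g i k)%:R) : R).
  apply: eq_bigr => m _; rewrite -mulr_sumr; congr (_ * _).
  rewrite [RHS](partition_big (@one_hot I) xpredT) //=; apply: eq_bigr => st _.
  rewrite born_suml mulr_suml; apply: eq_bigr => i /eqP <-.
  by rewrite /B guessE.
rewrite exchange_big /=; apply: eq_bigr => i _.
rewrite (bigD1 (g i k)) //= eqxx mulr1 big1 ?addr0 // => m /negbTE ->.
by rewrite !mulr0.
Qed.

End Guessing.

(** * Universal hashing as a bound on bias *)

Section Hashing.
Variable R : realType.

(* The diagonal contributes [\sum_x q x ^+ 2]; off the diagonal, universality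
   makes the average correlation of the signs nonpositive. *)
Lemma universal_sign_sum (M : nat -> finType) (H : hash_family M) l (q : M l -> R) :
  universal H -> (forall x, 0 <= q x) ->
  \sum_(h in H l) (\sum_x (-1) ^+ h x * q x) ^+ 2 <= #|H l|%:R * \sum_x q x ^+ 2.
Proof.
move=> uH q0.
have corr x y : \sum_(h in H l) ((-1) ^+ h x * (-1) ^+ h y : R) <=
    #|H l|%:R * (x == y)%:R.
  (* The product of signs is 1 on a collision and -1 otherwise. *)
  have -> : \sum_(h in H l) ((-1) ^+ h x * (-1) ^+ h y : R) =
      2%:R * #|[set h in H l | h x == h y]|%:R - #|H l|%:R.
    have -> : #|[set h in H l | h x == h y]| = (\sum_(h in H l) (h x == h y))%N.
      by rewrite -sum1dep_card big_mkcondr.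
    rewrite natr_sum mulr_sumr -[X in _ - X%:R]sum1_card natr_sum -sumrB.
    by apply: eq_bigr => h _; case: (h x) (h y) => [] [] /=; ring.
  have [->|nxy] := eqVneq x y.
    have -> : [set h in H l | h y == h y] = H l :> {set _}.
      by apply/setP => h; rewrite inE eqxx andbT.
    by rewrite mulr1; lra.
  have := uH l x y nxy; rewrite ler_pdivrMr ?ltr0n ?hashes_gt0//.
  (* Universality is a statement over [rat]; it is carried to [R] through natural numbers. *)
  move=> e; rewrite mulr0 subr_le0 -natrM ler_nat.
  by rewrite -(ler_nat rat) natrM; lra.
have -> : \sum_(h in H l) (\sum_x (-1) ^+ h x * q x) ^+ 2 =
    \sum_x \sum_y (q x * q y) * \sum_(h in H l) ((-1) ^+ h x * (-1) ^+ h y).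
  transitivity (\sum_(h in H l) \sum_x \sum_y
     (q x * q y) * ((-1) ^+ h x * (-1) ^+ h y)).
    apply: eq_bigr => h _; rewrite expr2 mulr_suml; apply: eq_bigr => x _.
    by rewrite mulr_sumr; apply: eq_bigr => y _; ring.
  rewrite exchange_big; apply: eq_bigr => x _.
  by rewrite exchange_big; apply: eq_bigr => y _; rewrite mulr_sumr.
apply: (@le_trans _ _ (\sum_x \sum_y (q x * q y) * (#|H l|%:R * (x == y)%:R))).
  by apply: ler_sum => x _; apply: ler_sum => y _; rewrite ler_wpM2l ?mulr_ge0.
rewrite mulr_sumr; apply: ler_sum => x _.
rewrite (bigD1 x) //= big1 ?addr0 ?eqxx.
  by rewrite mulr1 mulrC expr2.
by move=> y /negbTE; rewrite eq_sym => ->; rewrite !mulr0.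
Qed.

(** Scaling the AM-GM parameter by the total weight [Q] makes the first term linear in [q], so that
    over all outcomes and keys it sums to a multiple of [eps]. *)
Lemma universal_bias (M : nat -> finType) (H : hash_family M) l (q : M l -> R)
    x0 (eps : R) :
  universal H -> (forall x, 0 <= q x) -> (forall x, q x <= q x0) -> 0 < eps ->
  #|H l|%:R^-1 * \sum_(h in H l) `|\sum_x (-1) ^+ h x * q x|
    <= (eps * \sum_x q x + q x0 / eps) / 2%:R.
Proof.
move=> uH q0 qmax e0; set Q := \sum_x q x.
have Q0 : 0 <= Q by exact: sumr_ge0.
have H0 : 0 < #|H l|%:R :> R by rewrite ltr0n hashes_gt0.
rewrite ler_pdivrMl//.
have [Qz|Qn] := eqVneq Q 0.
  have qz x : q x = 0.
    move/eqP: Qz; rewrite psumr_eq0// => /allP/(_ x).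
    by move=> /(_ (mem_index_enum _))/eqP.
  rewrite big1; first by rewrite Qz qz !(mulr0, mul0r, addr0).
  by move=> h _; rewrite big1 ?normr0// => x _; rewrite qz mulr0.
have Qp : 0 < Q by rewrite lt0r Qn.
(* AM-GM: [2 |s| <= eps Q + s^2 / (eps Q)] *)
have amgm (s : R) : `|s| <= (eps * Q + s ^+ 2 / (eps * Q)) / 2%:R.
  have t0 : 0 < eps * Q by rewrite mulr_gt0.
  rewrite -(real_normK (num_real s)) ler_pdivlMr// -subr_ge0.
  have -> : eps * Q + `|s| ^+ 2 / (eps * Q) - `|s| * 2%:R =
     (`|s| - eps * Q) ^+ 2 / (eps * Q) by field; rewrite Qn gt_eqF.
  by rewrite divr_ge0 ?sqr_ge0 ?ltW.
apply: (le_trans (ler_sum _ (fun h _ => amgm _))).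
rewrite -mulr_suml mulrA ler_pM2r ?invr_gt0// big_split /= sumr_const -mulr_suml.
rewrite mulrDr -[(eps * Q) *+ _]mulr_natl lerD2l ler_pdivrMr ?mulr_gt0//.
apply: (le_trans (universal_sign_sum uH q0)).
have -> : #|H l|%:R * (q x0 / eps) * (eps * Q) = #|H l|%:R * (q x0 * Q).
  by field; rewrite gt_eqF.
rewrite ler_wpM2l// mulr_sumr; apply: ler_sum => x _.
by rewrite expr2 ler_wpM2r.
Qed.

End Hashing.

(** * Average bias over keys and outcomes *)

Section Bias.
Variables (R : realType) (P : ske R) (H : hash_family (msg P)) (l : nat).

(** Over all outcomes and averaged over keys, the weights [q] have total mass 1, while their maxima
    add up to the success probability of guessing the likeliest message. *)
Lemma hash_bias_le (I : finType) (E : I -> 'M[R[i]]_(ctdim P l))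
    (eps : R) :
  universal H -> povm E -> 0 < eps ->
  \sum_k gen P l k * \sum_i #|H l|%:R^-1 * \sum_(h in H l)
    `|\sum_x (-1) ^+ h x * (#|msg P l|%:R^-1 * born (E i) (enc P l k x))|
  <= (eps + ow_max_adv P l / eps) / 2%:R.
Proof.
move=> uH pE e0; have [g0 g1] := gen_dist P l.
have /card_gt0P[m0 _] := msg_gt0 P l.
pose q i k x : R := #|msg P l|%:R^-1 * born (E i) (enc P l k x).
have q0 i k x : 0 <= q i k x.
  by rewrite mulr_ge0 ?invr_ge0// born_ge0//; [case: pE|case: (enc_density k x)].
pose g i k := [arg max_(x > m0) q i k x]%O.
have qmax i k x : q i k x <= q i k (g i k).
  by rewrite /g; case: arg_maxP => // y _; apply.
apply: (@le_trans _ _ (\sum_k gen P l k *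
    \sum_i (eps * (\sum_x q i k x) + q i k (g i k) / eps) / 2%:R)).
  apply: ler_sum => k _; rewrite ler_wpM2l//; apply: ler_sum => i _.
  by apply: (universal_bias (q := q i k)).
have -> : \sum_k gen P l k *
    \sum_i (eps * (\sum_x q i k x) + q i k (g i k) / eps) / 2%:R =
    (eps * \sum_k gen P l k * \sum_i \sum_x q i k x +
     (\sum_k gen P l k * \sum_i q i k (g i k)) / eps) / 2%:R.
  rewrite mulr_sumr [X in _ + X]mulr_suml -big_split mulr_suml.
  apply: eq_bigr => k _ /=; rewrite -mulr_suml big_split /= -mulr_sumr -mulr_suml.
  ring.
have -> : \sum_k gen P l k * \sum_i \sum_x q i k x = 1.
  rewrite -[RHS]g1; apply: eq_bigr => k _; rewrite exchange_big /=.
  rewrite -[RHS]mulr1 -(msg_inv_sum P l); congr (_ * _).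
  apply: eq_bigr => x _.
  by rewrite -mulr_sumr (born_sum_povm pE) ?mulr1//; exact: enc_density.
rewrite mulr1 ler_pM2r ?invr_gt0// lerD2l ler_pM2r ?invr_gt0//.
exact: ow_guess_le.
Qed.

End Bias.

(** * Reduction from indistinguishability to one-wayness *)

Section OneTimeSecurity.
Variable R : realType.

Lemma povm_psdmx d (I : finType) (E : I -> 'M[R[i]]_d) i : povm E -> psdmx (E i).
Proof. by case. Qed.

Lemma psdmx_invn d n (A : 'M[R[i]]_d) : psdmx A -> psdmx (n%:R^-1 *: A).
Proof.
by move=> pA v; rewrite -scalemxAr -scalemxAl mxE mulr_ge0 ?invr_ge0 ?ler0n.
Qed.

Lemma sum_partial_effect_povm d n (I : finType) b (S : 'M[R[i]]_n)
    (A : I -> 'M[R[i]]_((d + d) * n)) :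
  povm A -> \sum_i partial_effect b S (A i) = (\tr S)%:M.
Proof.
move=> [_ A1]; apply/matrixP => j k; rewrite summxE.
under eq_bigr do rewrite mxE.
rewrite -(raddf_sum (mxtrace (n := _))) -mulmx_suml A1 mul1mx.
rewrite [LHS]mxtrace_tens mxtrace_cq.
rewrite mxE /mxtrace (bigD1 k) //= big1 => [|i /negbTE ik]; last by rewrite mxE ik.
by rewrite mxE eqxx addr0 /= eq_sym; case: eqP; rewrite ?mul1r ?mul0r.
Qed.

(** For distinct messages the two padded bits are opposite, so the gap is, up to a global sign, the
    difference of the signed sums for the two values of the bit. The bound is thus free of [r], [m0]
    and [m1]. *)
Lemma pad_gap_le (X : finType) (h : X -> bool) (T : bool -> X -> R) r m0 m1 :
  `|\sum_x T (r (+) h x (+) m0) x - \sum_x T (r (+) h x (+) m1) x|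
    <= \sum_b `|\sum_x (-1) ^+ h x * T b x|.
Proof.
have [<-|m01] := eqVneq m0 m1; first by rewrite subrr normr0 sumr_ge0.
have -> : \sum_x T (r (+) h x (+) m0) x - \sum_x T (r (+) h x (+) m1) x =
    (-1) ^+ (r (+) m0) * (\sum_x (-1) ^+ h x * T false x - \sum_x (-1) ^+ h x * T true x).
  rewrite -!sumrB mulr_sumr; apply: eq_bigr => x _.
  by case: r (h x) m0 m1 m01 => [] [] [] [] //= _; ring.
by rewrite normrM normr_sign mul1r big_bool [leRHS]addrC; exact: ler_normB.
Qed.

Section Scheme.
Variables (P : ske R) (H : hash_family (msg P)) (l : nat).

Lemma ute_gen_sum (f : key P l -> {ffun msg P l -> bool} -> R) :
  \sum_(sk : ute_key P l) ute_gen H sk * f sk.1.1 sk.1.2 =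
  \sum_k gen P l k * (#|H l|%:R^-1 * \sum_(h in H l) f k h).
Proof.
pose w k h : R := gen P l k * ((h \in H l)%:R / #|H l|%:R).
rewrite (eq_bigr (fun sk : ute_key P l =>
  w sk.1.1 sk.1.2 * 2^-1 * f sk.1.1 sk.1.2)); last by case=> [[]].
rewrite -(pair_bigA _ (fun p (r : bool) => w p.1 p.2 * 2^-1 * f p.1 p.2)) /=.
rewrite (eq_bigr (fun p => w p.1 p.2 * f p.1 p.2)); last first.
  by move=> p _; rewrite big_bool /=; lra.
rewrite -(pair_bigA _ (fun k h => w k h * f k h)) /=.
apply: eq_bigr => k _; rewrite mulrA mulr_sumr [RHS]big_mkcond.
apply: eq_bigr => h _; rewrite /w; case: (h \in H l) => /=; ring.
Qed.

Lemma born_ute_enc n (A : 'M[R[i]]_((ctdim P l + ctdim P l) * n)) S k h r m :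
  born A (@ute_enc R P l (k, h, r) m *t S) =
  \sum_x #|msg P l|%:R^-1 * born (partial_effect (r (+) h x (+) m) S A) (enc P l k x).
Proof.
rewrite /= tensmx_suml born_sumr; apply: eq_bigr => x _.
by rewrite tensmxZl born_invnr born_partial_effect.
Qed.

Lemma ind_gap_le (a : ind_adv (ute H) l) (eps : R) :
  universal H -> 0 < eps ->
  `|ind_out1 a false - ind_out1 a true| <= eps + ow_max_adv P l / eps.
Proof.
case: a => n len A1 A2 B A1_psd A1_tr A2_povm B_dist uH e0; rewrite /ind_out1 /=.
pose F (p : bool * bool) (s : len.-tuple bool * bool) :=
  partial_effect s.2 (A1 p.1 p.2) (A2 s.1).
pose E (i : (bool * bool) * (len.-tuple bool * bool)) := 2%:R^-1 *: F i.1 i.2.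
(* For each value of the bit the effects [F] sum to the identity; the factor 1/2 in [E] accounts for
   sampling that bit uniformly. *)
have pE : povm E.
  split=> [[p s]|].
    by apply: psdmx_invn; apply: psdmx_partial_effect => //; exact: povm_psdmx.
  rewrite /E -scaler_sumr -(pair_bigA _ F) /=.
  under eq_bigr => p _.
    rewrite -(pair_bigA _ (fun st b => F p (st, b))) exchange_big /=.
    under eq_bigr do rewrite (sum_partial_effect_povm _ _ A2_povm).
    over.
  rewrite exchange_big /=.
  under eq_bigr do rewrite -(raddf_sum (scalar_mx (n := _))).
  rewrite pair_bigA /= in A1_tr.
  rewrite A1_tr big_bool /= -mulr2n -[1%:M *+ 2]scaler_nat scalerA.
  by rewrite mulVf ?scale1r// pnatr_eq0.
pose G p s k (h : {ffun msg P l -> bool}) :=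
  `|\sum_x (-1) ^+ h x * (#|msg P l|%:R^-1 * born (E (p, s)) (enc P l k x))|.
apply: (@le_trans _ _ (\sum_m0 \sum_m1 \sum_(sk : ute_key P l) ute_gen H sk *
    \sum_st \sum_b 2%:R * G (m0, m1) (st, b) sk.1.1 sk.1.2)).
  rewrite -sumrB (le_trans (ler_norm_sum _ _ _))//; apply: ler_sum => m0 _.
  rewrite -sumrB (le_trans (ler_norm_sum _ _ _))//; apply: ler_sum => m1 _.
  rewrite -sumrB (le_trans (ler_norm_sum _ _ _))//; apply: ler_sum => [[[k h] r]] _.
  rewrite -mulrBr normrM ger0_norm; last by case: (ute_gen_dist H l).
  apply: ler_wpM2l; first by case: (ute_gen_dist H l).
  rewrite -sumrB (le_trans (ler_norm_sum _ _ _))//; apply: ler_sum => st _.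
  have [B0 _] := B_dist st (k, h, r).
  rewrite -mulrBl normrM (ger0_norm (B0 _)).
  (* The second stage enters only through a probability, bounded by 1. *)
  apply: le_trans (ler_piMr (normr_ge0 _) (is_dist_le1 _ (B_dist st (k, h, r)))) _.
  rewrite !born_ute_enc.
  apply: le_trans (pad_gap_le h (fun b x => #|msg P l|%:R^-1 *
    born (partial_effect b (A1 m0 m1) (A2 st)) (enc P l k x)) r m0 m1) _.
  apply: ler_sum => b _; rewrite /G -[2%:R]ger0_norm// -normrM mulr_sumr.
  rewrite le_eqVlt; apply/orP; left; apply/eqP; congr `|_|; apply: eq_bigr => x _.
  rewrite born_invnl /F /=; field.
  by rewrite pnatr_eq0 -lt0n msg_gt0.
(* Since [G] does not involve [r], the pad averages out, leaving the average over [k] and [h]. *)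
suff -> : \sum_m0 \sum_m1 \sum_(sk : ute_key P l) ute_gen H sk *
    \sum_st \sum_b 2%:R * G (m0, m1) (st, b) sk.1.1 sk.1.2 =
    2%:R * \sum_k gen P l k * \sum_i #|H l|%:R^-1 * \sum_(h in H l) G i.1 i.2 k h.
  by rewrite -ler_pdivlMl// mulrC; have := hash_bias_le uH pE e0.
rewrite pair_bigA /=.
under eq_bigr => p _.
  rewrite (ute_gen_sum (fun k h => \sum_st \sum_b 2%:R * G (p.1, p.2) (st, b) k h)).
  over.
rewrite exchange_big mulr_sumr; apply: eq_bigr => k _ /=.
rewrite -mulr_sumr mulrCA; congr (_ * _).
rewrite -(pair_bigA _ (fun p s => #|H l|%:R^-1 * \sum_(h in H l) G p s k h)) /=.
rewrite mulr_sumr; apply: eq_bigr => [[m0 m1]] _ /=.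
rewrite -[X in _ = 2%:R * X]mulr_sumr mulrCA; congr (_ * _).
rewrite [in RHS]exchange_big mulr_sumr; apply: eq_bigr => h _ /=.
by rewrite pair_bigA mulr_sumr; apply: eq_bigr => [[st b]].
Qed.

End Scheme.
End OneTimeSecurity.

(** * Asymptotics and choice of [eps] *)

Lemma negligible_exp (R : realType) (d : R) (f : nat -> R) : 0 < d ->
  (\forall n \near \oo, `|f n| <= 2 * 2 `^ (- (d * n%:R)))%classic -> Defs.negligible f.
Proof.
move=> d0 fd k; have ln2 : 0 < ln (2 : R) by rewrite ln_gt0// ltr1n.
have t0 : 0 < d * ln 2 by rewrite mulr_gt0.
set t := d * ln 2 in t0.
near=> n.
apply: (@le_trans _ _ (2 * 2 `^ (- (d * n%:R)))); first by near: n.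
have n0 : 0 < n%:R :> R by near: n; exact: nbhs_infty_gtr.
have expE : 2 `^ (- (d * n%:R)) = (expR (t * n%:R))^-1 :> R.
  by rewrite /powR pnatr_eq0 /= -expRN /t; congr expR; ring.
(* The exponential exceeds its Taylor term of degree [k.+1], which is at least twice [n%:R ^+ k]
   beyond the threshold [nbig]. *)
have := expR_ge1Dxn k (ltW (mulr_gt0 t0 n0)).
have nbig : 2 * k.+1`!%:R / t ^+ k.+1 <= n%:R by near: n; exact: nbhs_infty_ger.
rewrite expE => le_exp; rewrite ler_pdivrMr ?expR_gt0//.
rewrite ler_pdivlMl ?exprn_gt0//.
apply: le_trans le_exp; apply: ler_wpDl => //.
rewrite ler_pdivlMr ?ltr0n ?fact_gt0// exprMn.
rewrite ler_pdivrMr ?exprn_gt0// in nbig.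
rewrite [n%:R ^+ k.+1]exprS mulrCA mulrA -[leRHS]mulrC -mulrA.
by rewrite ler_wpM2l ?exprn_ge0.
Unshelve. all: by end_near.
Qed.

Theorem theorem3p10 (R : realType) (P : ske R) (H : hash_family (msg P)) :
  utske P ->
  universal H -> exp_poly_size H ->
  ow_secure P -> exp_small (ow_max_adv P) ->
  ind_secure (ute H).
Proof.
move=> _ uH _ _ [c c0 small] a.
(* Halving the rate makes [e] the square root of the bound on [ow_max_adv], so both terms of
   [ind_gap_le] are at most [e]. *)
have d0 : 0 < c / 2%:R by rewrite divr_gt0.
apply: (negligible_exp d0); near=> n.
set e : R := 2 `^ (- (c / 2%:R * n%:R)).
have e0 : 0 < e by exact: powR_gt0.
have ee : e * e = 2 `^ (- (c * n%:R)).
  by rewrite -powRD ?pnatr_eq0 ?implybT//; congr (_ `^ _); field.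
rewrite normr_id; apply: le_trans (ind_gap_le (a n) uH e0) _.
have -> : 2 * e = e + e by ring.
rewrite lerD2l ler_pdivrMr// ee; by near: n.
Unshelve. all: by end_near.
Qed.
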